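(* Let $\mathcal C$ be a small category and $G$ a group. The assignment to a functor $F\colon\mathcal C\to G$ of the simplicial principal $G$-bundle $N\Pi_F\colon N(\mathcal P_{\mathcal C,F})\to N\mathcal C$ induces an injection from $\mathcal D(\mathcal C,G)=\mathrm{Funct}(\mathcal C,G)/\mathrm{Map}(\mathrm{Ob}_{\mathcal C},G)$ to the set of isomorphism classes of simplicial principal $G$-bundles on the nerve $N\mathcal C$. Thus $\mathcal D(\mathcal C,G)$ parametrizes the isomorphism classes of simplicial principal $G$-bundles on $N\mathcal C$ of the kind $N\Pi_F$, for some functor $F\colon\mathcal C\to G$.
   Context: All categories are small. Composition is written in diagrammatic order: for $f_1\colon x_0\to x_1$ and $f_2\colon x_1\to x_2$ the composite $x_0\to x_2$ is $f_1f_2$. The group $G$ is viewed as a category with a single object; a functor $F\colon\mathcal C\to G$ thus assigns to each morphism $f$ an element $F(f)\in G$ with $F(f_1f_2)=F(f_1)F(f_2)$ and $F(\mathrm{Id})=e$. (In the topological or smooth case, $\mathcal C$, $G$, functors and maps are topological/smooth.) $\mathrm{Funct}(\mathcal C,G)$ is the set of functors. The group $\mathrm{Map}(\mathrm{Ob}_{\mathcal C},G)$ of maps $\Phi\colon\mathrm{Ob}_{\mathcal C}\to G$ acts on $\mathrm{Funct}(\mathcal C,G)$ via natural transformations: $F_2=\Phi(F_1)$ means that for every morphism $f\colon x\to y$ of $\mathcal C$ one has $F_1(f)\Phi(y)=\Phi(x)F_2(f)$. $\mathcal D(\mathcal C,G)$ is the set of orbits. The path category $\mathcal PG$ has object set $G$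 and morphism set $G\times G$, with $(y_1,y_2)$ the unique morphism from $y_1$ to $y_2$. The functor $\Pi\colon\mathcal PG\to G$ sends $(y_1,y_2)$ to $y_1y_2^{-1}$; $G$ acts on $\mathcal PG$ from the right by (diagonal) right translation. $\mathcal P_{\mathcal C,F}$ is the pullback category of $F\colon\mathcal C\to G$ and $\Pi\colon\mathcal PG\to G$: its objects are pairs $(x,y)\in\mathrm{Ob}_{\mathcal C}\times G$ and its morphisms are triples $(f,y_1,y_2)$ with $f$ a morphism of $\mathcal C$ and $F(f)=y_1y_2^{-1}$. $\Pi_F\colon\mathcal P_{\mathcal C,F}\to\mathcal C$ is the projection; $G$ acts freely from the right on $\mathcal P_{\mathcal C,F}$ and $\mathcal P_{\mathcal C,F}/G\cong\mathcal C$. $N$ denotes the nerve, and $N\Pi_F$ is the resulting simplicial principal right $G$-bundle ($G$ regarded as a constant simplicial group). A simplicial principal $G$-bundle on a simplicial set $X$ is a simplicial set $E$ with a degreewise free simplicial right $G$-action and a simplicial map $E\to X$ inducing $E/G\cong X$; isomorphisms are $G$-equivariant simplicial isomorphisms over $\mathrm{Id}_X$. *)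

(* Defs.v *)
From HB Require Import structures.
From mathcomp Require Import all_boot all_order.
From mathcomp Require Import boolp.

Set Implicit Arguments.
Unset Strict Implicit.
Unset Printing Implicit Defensive.

Import Order.TTheory.

(* Composition is in diagrammatic order: mcomp f g is "f, then g". *)
Record category := Category {
  ob :> Type;
  hom : ob -> ob -> Type;
  idm : forall x, hom x x;
  mcomp : forall x y z, hom x y -> hom y z -> hom x z;
  mcomp1m : forall x y (f : hom x y), mcomp (idm x) f = f;
  mcompm1 : forall x y (f : hom x y), mcomp f (idm y) = f;
  mcompA : forall w x y z (f : hom w x) (g : hom x y) (h : hom y z),
    mcomp f (mcomp g h) = mcomp (mcomp f g) h }.

Arguments hom {c}.
Arguments idm {c}.
Arguments mcomp {c x y z}.

Record functor (C D : category) := Functor {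
  fobj :> C -> D;
  fmap : forall x y, hom x y -> hom (fobj x) (fobj y);
  fmap1 : forall x, fmap (idm x) = idm (fobj x);
  fmapM : forall x y z (f : hom x y) (g : hom y z),
    fmap (mcomp f g) = mcomp (fmap f) (fmap g) }.

Arguments fmap {C D} F {x y} f : rename.

Section Compose.
Variables (C D E : category) (F : functor C D) (H : functor D E).

Definition compose_map x y (f : @hom C x y) := fmap H (fmap F f).

Fact compose_map1 x : compose_map (idm x) = idm (H (F x)).
Proof. by rewrite /compose_map !fmap1. Qed.

Fact compose_mapM x y z (f : @hom C x y) (g : hom y z) :
  compose_map (mcomp f g) = mcomp (compose_map f) (compose_map g).
Proof. by rewrite /compose_map !fmapM. Qed.

(* "F, then H" *)
Definition compose : functor C E := Functor compose_map1 compose_mapM.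
End Compose.

Definition arrow (C : category) x y (f : @hom C x y) :
  {p : C * C & hom p.1 p.2} := existT _ (x, y) f.

Lemma arrow_inj (C : category) (x y : C) : injective (@arrow C x y).
Proof.
move=> f g efg; have := projT2_eq efg.
by rewrite (Prop_irrelevance (projT1_eq efg) erefl).
Qed.

Lemma functor_eq (C D : category) (F H : functor C D) :
  (forall x y (f : hom x y), arrow (fmap F f) = arrow (fmap H f)) -> F = H.
Proof.
move=> eFH; have eo : fobj F = fobj H.
  by apply: funext => x; have /(congr1 (fun a => (projT1 a).1)) := eFH _ _ (idm x).
case: F H eo eFH => [Fo Fm F1 FM] [Ho Hm H1 HM] /= eo; subst Ho => eFH.
have em : Fm = Hm.
  apply: functional_extensionality_dep => x; apply: functional_extensionality_dep => y.
  apply: funext => f; exact: arrow_inj (eFH x y f).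
subst Hm; congr Functor; exact: Prop_irrelevance.
Qed.

Section Deloop.
Local Open Scope group_scope.
Variable G : groupType.

Definition deloop : category :=
  @Category unit (fun _ _ => G) (fun _ => 1) (fun _ _ _ a b => a * b)
    (fun _ _ => @mul1g G) (fun _ _ => @mulg1 G) (fun _ _ _ _ => @mulgA G).

(* fmap F f at type G, where the group operations are available. *)
Definition gval (C : category) (F : functor C deloop) (x y : C)
  (f : hom x y) : G := fmap F f.

Lemma gval1 C (F : functor C deloop) x : gval F (idm x) = 1.
Proof. exact: (fmap1 F). Qed.

Lemma gvalM C (F : functor C deloop) x y z (f : hom x y) (g : hom y z) :
  gval F (mcomp f g) = gval F f * gval F g.
Proof. exact: (fmapM F). Qed.

(* Exactly one morphism (y1, y2) from y1 to y2. *)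
Definition pathcat : category.
Proof.
by refine (@Category G (fun _ _ => unit) (fun _ => tt) (fun _ _ _ _ _ => tt)
  _ _ _) => // x y [].
Defined.

Definition path_functor (K : category) (y : K -> G) : functor K pathcat :=
  @Functor K pathcat y (fun _ _ _ => tt) (fun _ => erefl)
    (fun _ _ _ _ _ => erefl).

Lemma path_functor_eq (K : category) (F H : functor K pathcat) :
  (forall x, F x = H x) -> F = H.
Proof.
move=> eFH; apply: functor_eq => x y f.
by case: (fmap F f) (fmap H f) => [] []; rewrite !eFH.
Qed.

Fact Pi_map1 (y : pathcat) : y * y^-1 = 1 :> G. Proof. exact: mulgV. Qed.

Fact Pi_mapM (y1 y2 y3 : pathcat) :
  y1 * y3^-1 = (y1 * y2^-1) * (y2 * y3^-1) :> G.
Proof. by rewrite mulgA mulgVK. Qed.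

(* (y1, y2) |-> y1 y2^-1 *)
Definition Pi : functor pathcat deloop :=
  @Functor pathcat deloop (fun _ => tt) (fun y1 y2 _ => y1 * y2^-1)
    Pi_map1 (fun y1 y2 y3 _ _ => Pi_mapM y1 y2 y3).

Lemma PiE y1 y2 (p : @hom pathcat y1 y2) : gval Pi p = y1 * y2^-1.
Proof. by []. Qed.

Definition rtrans (g : G) : functor pathcat pathcat :=
  path_functor (fun y : pathcat => y * g).

End Deloop.

Section Pullback.
Variables (G : groupType) (A B : category).
Variables (F : functor A (deloop G)) (H : functor B (deloop G)).

Definition pb_hom (u v : A * B) :=
  {p : hom u.1 v.1 * hom u.2 v.2 | gval F p.1 = gval H p.2}.

Lemma pb_hom_eq u v (p q : pb_hom u v) : sval p = sval q -> p = q.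
Proof.
case: p q => [p hp] [q hq] /= epq; subst q.
congr exist; exact: Prop_irrelevance.
Qed.

Fact pb_id_proof (u : A * B) : gval F (idm u.1) = gval H (idm u.2).
Proof. by rewrite !gval1. Qed.

Fact pb_comp_proof u v w (p : pb_hom u v) (q : pb_hom v w) :
  gval F (mcomp (sval p).1 (sval q).1) = gval H (mcomp (sval p).2 (sval q).2).
Proof. by rewrite !gvalM (svalP p) (svalP q). Qed.

Definition pb_id u : pb_hom u u := exist _ (idm u.1, idm u.2) (pb_id_proof u).

Definition pb_comp u v w (p : pb_hom u v) (q : pb_hom v w) : pb_hom u w :=
  exist _ (mcomp (sval p).1 (sval q).1, mcomp (sval p).2 (sval q).2)
    (pb_comp_proof p q).

Fact pb_comp1m u v (p : pb_hom u v) : pb_comp (pb_id u) p = p.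
Proof. by apply: pb_hom_eq; case: p => [[a b] ?] /=; rewrite !mcomp1m. Qed.

Fact pb_compm1 u v (p : pb_hom u v) : pb_comp p (pb_id v) = p.
Proof. by apply: pb_hom_eq; case: p => [[a b] ?] /=; rewrite !mcompm1. Qed.

Fact pb_compA t u v w (p : pb_hom t u) (q : pb_hom u v) (r : pb_hom v w) :
  pb_comp p (pb_comp q r) = pb_comp (pb_comp p q) r.
Proof. by apply: pb_hom_eq => /=; rewrite !mcompA. Qed.

(* The group category has a single object, so that every pair of objects
   belongs to the pullback. *)
Definition pullback : category := Category pb_comp1m pb_compm1 pb_compA.

Definition pb_fst : functor pullback A :=
  @Functor pullback A (fun u => u.1) (fun u v p => (sval p).1)
    (fun _ => erefl) (fun _ _ _ _ _ => erefl).

Definition pb_snd : functor pullback B :=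
  @Functor pullback B (fun u => u.2) (fun u v p => (sval p).2)
    (fun _ => erefl) (fun _ _ _ _ _ => erefl).

Section Pairing.
Variables (K : category) (a : functor K A) (b : functor K B).
Hypothesis hab : forall x y (f : hom x y), gval F (fmap a f) = gval H (fmap b f).

Definition pb_pair_map x y (f : @hom K x y) :
  @hom pullback (a x, b x) (a y, b y) := exist _ (fmap a f, fmap b f) (hab f).

Fact pb_pair_map1 x : pb_pair_map (idm x) = idm ((a x, b x) : pullback).
Proof. by apply: pb_hom_eq; rewrite /= !fmap1. Qed.

Fact pb_pair_mapM x y z (f : @hom K x y) (g : hom y z) :
  pb_pair_map (mcomp f g) = mcomp (pb_pair_map f) (pb_pair_map g).
Proof. by apply: pb_hom_eq; rewrite /= !fmapM. Qed.

Definition pb_pair : functor K pullback :=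
  @Functor K pullback (fun x => (a x, b x)) pb_pair_map
    pb_pair_map1 pb_pair_mapM.
End Pairing.

Lemma pb_arrow_eq (u v u' v' : pullback) (p : hom u v) (p' : hom u' v') :
  arrow (fmap pb_fst p) = arrow (fmap pb_fst p') ->
  arrow (fmap pb_snd p) = arrow (fmap pb_snd p') -> arrow p = arrow p'.
Proof.
case: u v u' v' p p' => [a b] [c d] [a' b'] [c' d'] [[f g] h] [[f' g'] h'] /=.
move=> e1 e2.
have /= [? ?] := projT1_eq e1; have /= [? ?] := projT1_eq e2; subst a' b' c' d'.
have ? := arrow_inj e1; have ? := arrow_inj e2; subst f' g'.
apply: (congr1 (@arrow pullback (a, b) (c, d))); exact: pb_hom_eq.
Qed.

Lemma pb_functor_eq (K : category) (s t : functor K pullback) :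
  compose s pb_fst = compose t pb_fst ->
  compose s pb_snd = compose t pb_snd -> s = t.
Proof.
move=> e1 e2; apply: functor_eq => x y f; apply: pb_arrow_eq.
- exact: (congr1 (fun E : functor K A => arrow (fmap E f)) e1).
- exact: (congr1 (fun E : functor K B => arrow (fmap E f)) e2).
Qed.

End Pullback.

Section PathPullback.
Local Open Scope group_scope.
Variables (G : groupType) (C : category) (F : functor C (deloop G)).

(* P_{C,F}: objects (x, y), morphisms (f, y1, y2) with F f = y1 y2^-1. *)
Definition PCF : category := pullback F (Pi G).

Definition Pi_F : functor PCF C := pb_fst F (Pi G).

Fact PCF_rtrans_proof (g : G) (u v : PCF) (p : hom u v) :
  gval F (fmap Pi_F p) =
  gval (Pi G) (fmap (compose (pb_snd F (Pi G)) (rtrans g)) p).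
Proof.
rewrite [LHS](svalP p) !PiE /= invgM mulgA; congr (_ * _).
by rewrite mulgK.
Qed.

(* (x, y) |-> (x, y g) and (f, y1, y2) |-> (f, y1 g, y2 g) *)
Definition PCF_rtrans (g : G) : functor PCF PCF :=
  pb_pair (PCF_rtrans_proof g).

End PathPullback.

(* The set of equivalence classes, each one being the predicate R x of its
   elements; meant for equivalence relations R. *)
Definition quot (T : Type) (R : T -> T -> Prop) :=
  {A : T -> Prop | exists x, A = R x}.

Definition quot_class (T : Type) (R : T -> T -> Prop) (x : T) : quot R :=
  exist _ (R x) (ex_intro _ x erefl).

Section Orbits.
Local Open Scope group_scope.
Variables (C : category) (G : groupType).
Implicit Types F : functor C (deloop G).

(* F2 = Phi (F1): Phi is a natural transformation from F1 to F2. *)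
Definition gauge (Phi : C -> G) F1 F2 : Prop :=
  forall x y (f : @hom C x y), gval F1 f * Phi y = Phi x * gval F2 f.

Definition gauge_equiv F1 F2 : Prop := exists Phi, gauge Phi F1 F2.

Lemma gauge_equiv_refl F : gauge_equiv F F.
Proof. by exists (fun=> 1) => x y f; rewrite mulg1 mul1g. Qed.

Lemma gauge_equiv_sym F1 F2 : gauge_equiv F1 F2 -> gauge_equiv F2 F1.
Proof.
case=> Phi e; exists (fun x => (Phi x)^-1) => x y f.
by apply: (mulgI (Phi x)); rewrite mulgA -e mulgK mulgA mulgV mul1g.
Qed.

Lemma gauge_equiv_trans F1 F2 F3 :
  gauge_equiv F1 F2 -> gauge_equiv F2 F3 -> gauge_equiv F1 F3.
Proof.
move=> [Phi e] [Psi e']; exists (fun x => Phi x * Psi x) => x y f.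
by rewrite mulgA e -mulgA e' mulgA.
Qed.

Definition orbits := quot gauge_equiv.

Definition orbit_of F : orbits := quot_class gauge_equiv F.

End Orbits.

Notation simplex_map m n := {omorphism 'I_m.+1 -> 'I_n.+1}.

Record sset := SSet {
  simplex :> nat -> Type;
  sact : forall m n, simplex_map m n -> simplex n -> simplex m;
  sact_id : forall n (s : simplex n), sact (idfun : simplex_map n n) s = s;
  sact_comp : forall l m n (f : simplex_map m n) (g : simplex_map l m)
    (s : simplex n), sact (f \o g : simplex_map l n) s = sact g (sact f s) }.

Arguments sact {X m n} f s : rename.

Record smap (X Y : sset) := SMap {
  smap_fun :> forall n, X n -> Y n;
  smap_nat : forall m n (f : simplex_map m n) (s : X n),
    smap_fun (sact f s) = sact f (smap_fun s) }.

(* The poset [n] = {0 < ... < n} as a category. *)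
Definition ord_cat (n : nat) : category.
Proof.
by refine (@Category 'I_n.+1 (fun i j => (i <= j)%O) (fun i => le_refl i)
  (fun i j k ij jk => le_trans ij jk) _ _ _) => *; apply: bool_irrelevance.
Defined.

Definition ord_functor m n (f : simplex_map m n) :
  functor (ord_cat m) (ord_cat n).
Proof.
by refine (@Functor (ord_cat m) (ord_cat n) f
  (fun i j ij => omorph_le f ij) _ _) => *; apply: bool_irrelevance.
Defined.

Section Nerve.
Variable C : category.

(* n-simplices are functors [n] -> C, i.e. strings of n composable
   morphisms. *)
Definition nerve_act m n (f : simplex_map m n) (s : functor (ord_cat n) C) :
  functor (ord_cat m) C := compose (ord_functor f) s.

Fact nerve_act_id n (s : functor (ord_cat n) C) :
  nerve_act (idfun : simplex_map n n) s = s.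
Proof.
apply: functor_eq => i j ij /=.
by congr (arrow (fmap s _)); apply: bool_irrelevance.
Qed.

Fact nerve_act_comp l m n (f : simplex_map m n) (g : simplex_map l m)
  (s : functor (ord_cat n) C) :
  nerve_act (f \o g : simplex_map l n) s = nerve_act g (nerve_act f s).
Proof.
apply: functor_eq => i j ij /=.
by congr (arrow (fmap s _)); apply: bool_irrelevance.
Qed.

Definition nerve : sset := SSet nerve_act_id nerve_act_comp.
End Nerve.

Fact nerve_map_nat (C D : category) (F : functor C D) m n
  (f : simplex_map m n) (s : nerve C n) :
  compose (sact f s) F = sact f (compose s F : nerve D n).
Proof. exact: functor_eq. Qed.

Definition nerve_map (C D : category) (F : functor C D) :
  smap (nerve C) (nerve D) :=
  @SMap (nerve C) (nerve D) (fun n s => compose s F) (nerve_map_nat F).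

Section Bundles.
Local Open Scope group_scope.
Variables (X : sset) (G : groupType).

(* The last three fields say that proj induces, in each degree, a map
   E_n / G -> X_n that is well defined, injective and surjective. *)
Record bundle := Bundle {
  tot :> sset;
  gact : forall n, tot n -> G -> tot n;
  gact1 : forall n (e : tot n), gact e 1 = e;
  gactM : forall n (e : tot n) g h, gact e (g * h) = gact (gact e g) h;
  gact_simplicial : forall m n (f : simplex_map m n) (e : tot n) g,
    sact f (gact e g) = gact (sact f e) g;
  gact_free : forall n (e : tot n) g, gact e g = e -> g = 1;
  proj : smap tot X;
  proj_gact : forall n (e : tot n) g, proj n (gact e g) = proj n e;
  proj_orbit : forall n (e e' : tot n),
    proj n e = proj n e' -> exists g, e' = gact e g;
  proj_surj : forall n (x : X n), exists e : tot n, proj n e = x }.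

Definition bundle_iso (P Q : bundle) : Prop :=
  exists phi : smap P Q,
    [/\ forall n, bijective (phi n),
        forall n (e : P n) g, phi n (gact e g) = gact (phi n e) g &
        forall n (e : P n), proj Q n (phi n e) = proj P n e].

Lemma bundle_iso_refl P : bundle_iso P P.
Proof.
by exists (@SMap P P (fun n e => e) (fun _ _ _ _ => erefl)); split=> //= n; exists id.
Qed.

Lemma bundle_iso_sym P Q : bundle_iso P Q -> bundle_iso Q P.
Proof.
case=> phi [bij eqv over].
have ex n : exists g, cancel (phi n) g /\ cancel g (phi n).
  by case: (bij n) => g gK Kg; exists g.
pose psi n := sval (cid (ex n)).
have psiK n : cancel (phi n) (psi n) by case: (svalP (cid (ex n))).
have phiK n : cancel (psi n) (phi n) by case: (svalP (cid (ex n))).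
have nat m n (f : simplex_map m n) (t : Q n) :
    psi m (sact f t) = sact f (psi n t).
  by rewrite -{1}[t]phiK -smap_nat psiK.
exists (SMap nat); split=> [n|n e g|n e] /=.
- by exists (phi n).
- by rewrite -{1}[e]phiK -eqv psiK.
- by rewrite -over phiK.
Qed.

Lemma bundle_iso_trans P Q R :
  bundle_iso P Q -> bundle_iso Q R -> bundle_iso P R.
Proof.
move=> [phi [b1 e1 o1]] [psi [b2 e2 o2]].
have nat m n (f : simplex_map m n) (s : P n) :
  psi m (phi m (sact f s)) = sact f (psi n (phi n s)) by rewrite !smap_nat.
exists (SMap nat); split=> [n|n e g|n e] /=.
- exact: bij_comp (b2 n) (b1 n).
- by rewrite e1 e2.
- by rewrite o2 o1.
Qed.

Definition bundle_classes := quot bundle_iso.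

Definition iso_class (P : bundle) : bundle_classes := quot_class bundle_iso P.

End Bundles.

Section NerveBundle.
Local Open Scope group_scope.
Variables (C : category) (G : groupType) (F : functor C (deloop G)).

Definition nerve_gact n (s : nerve (PCF F) n) (g : G) : nerve (PCF F) n :=
  nerve_map (PCF_rtrans F g) n s.

Lemma nerve_PCF_eq n (s t : nerve (PCF F) n) :
  nerve_map (Pi_F F) n s = nerve_map (Pi_F F) n t ->
  (forall i, (s i).2 = (t i).2) -> s = t.
Proof.
by move=> e1 e2; apply: pb_functor_eq => //; apply: path_functor_eq.
Qed.

Fact nerve_proj_gact n (s : nerve (PCF F) n) g :
  nerve_map (Pi_F F) n (nerve_gact s g) = nerve_map (Pi_F F) n s.
Proof. exact: functor_eq. Qed.

Fact nerve_gact1 n (s : nerve (PCF F) n) : nerve_gact s 1 = s.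
Proof.
by apply: nerve_PCF_eq => [|i]; rewrite ?nerve_proj_gact //= mulg1.
Qed.

Fact nerve_gactM n (s : nerve (PCF F) n) g h :
  nerve_gact s (g * h) = nerve_gact (nerve_gact s g) h.
Proof.
by apply: nerve_PCF_eq => [|i]; rewrite ?nerve_proj_gact //= mulgA.
Qed.

Fact nerve_gact_simplicial m n (f : simplex_map m n) (s : nerve (PCF F) n) g :
  sact f (nerve_gact s g) = nerve_gact (sact f s) g.
Proof. by rewrite /nerve_gact smap_nat. Qed.

Fact nerve_gact_free n (s : nerve (PCF F) n) g : nerve_gact s g = s -> g = 1.
Proof.
move=> /(congr1 (fun t : nerve (PCF F) n => (t ord0).2)) /= e.
by apply: (mulgI (s ord0).2); rewrite e mulg1.
Qed.

Lemma PCF_simplexE n (s : nerve (PCF F) n) (i j : ord_cat n) (ij : hom i j) :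
  gval F (fmap (nerve_map (Pi_F F) n s) ij) = (s i).2 * (s j).2^-1.
Proof. exact: (svalP (fmap s ij)). Qed.

Fact nerve_proj_orbit n (s t : nerve (PCF F) n) :
  nerve_map (Pi_F F) n s = nerve_map (Pi_F F) n t ->
  exists g, t = nerve_gact s g.
Proof.
move=> est; exists ((s ord0).2^-1 * (t ord0).2).
apply: nerve_PCF_eq => [|i]; first by rewrite nerve_proj_gact.
have := PCF_simplexE s (leq0n i : @hom (ord_cat n) ord0 i).
rewrite est PCF_simplexE /= => e.
apply: invg_inj; apply: (mulgI (t ord0).2).
by rewrite e !invgM invgK !mulgA mulgV mul1g.
Qed.

Fact nerve_proj_surj n (x : nerve C n) :
  exists s : nerve (PCF F) n, nerve_map (Pi_F F) n s = x.
Proof.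
pose h0 i : @hom (ord_cat n) ord0 i := leq0n i.
pose b : functor (ord_cat n) (pathcat G) :=
  path_functor (fun i : ord_cat n => (gval F (fmap x (h0 i)))^-1).
have hab (i j : ord_cat n) (ij : hom i j) :
    gval F (fmap x ij) = gval (Pi G) (fmap b ij).
  rewrite PiE /= invgK.
  have -> : h0 j = mcomp (h0 i) ij by apply: bool_irrelevance.
  by rewrite fmapM gvalM mulgA mulVg mul1g.
by exists (pb_pair hab); apply: functor_eq.
Qed.

Definition nerve_bundle : bundle (nerve C) G :=
  @Bundle (nerve C) G (nerve (PCF F)) nerve_gact nerve_gact1 nerve_gactM
    nerve_gact_simplicial nerve_gact_free (nerve_map (Pi_F F))
    nerve_proj_gact nerve_proj_orbit nerve_proj_surj.

End NerveBundle.

(* Main.v *)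
Require Import Defs.
From HB Require Import structures.
From mathcomp Require Import all_boot all_order.
From mathcomp Require Import boolp.

(** The theorem amounts to: two functors [F1], [F2] from [C] to [G] are related
    by a gauge transformation if and only if the bundles [nerve_bundle F1] and
    [nerve_bundle F2] are isomorphic ([nerve_bundle_isoP]).  The rest is formal:
    a map that preserves and reflects equivalence relations descends to an
    injection between the sets of classes ([quot_map_inj]).

    From gauge to bundles.  If [F1 f * Phi y = Phi x * F2 f] for all [f], then
    [(x, y) |-> (x, Phi x ^-1 * y)] extends to a functor [gauge_PCF] from
    [PCF F1] to [PCF F2] that lies over [C] and commutes with right
    translations.  Its nerve is a [G]-equivariant map over the identity, and
    such a map between principal bundles is always bijective
    ([equivariant_over_bij]).

    From bundles to gauge.  An equivariant map [phi] over the identity sends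
    the vertex [(x, 1)] to some [(x, psi x)], hence, by equivariance, [(x, y)]
    to [(x, psi x * y)].  As [phi] is simplicial, this formula governs the
    vertices of the image of every simplex ([bundle_map_vertex]).  Now lift an
    arrow [f : x -> y] to a 1-simplex of [PCF F1] with vertices [(x, a)] and
    [(y, b)]: then [F1 f = a * b^-1], while [phi] maps it to a 1-simplex over
    the same [f], so that [F2 f = (psi x * a) * (psi y * b)^-1], which is
    [psi x * F1 f * (psi y)^-1].  Thus [Phi x = (psi x)^-1] is a gauge
    transformation from [F1] to [F2]. *)

Set Implicit Arguments.
Unset Strict Implicit.
Unset Printing Implicit Defensive.

Import Order.TTheory.

(** * Quotients *)

Section Quotients.
Variables (T : Type) (R : T -> T -> Prop).

Lemma quot_ext (A B : quot R) : sval A = sval B -> A = B.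
Proof.
case: A B => A hA [B hB] /= eAB; subst B.
by congr exist; apply: Prop_irrelevance.
Qed.

Lemma quot_class_surj (A : quot R) : exists x, quot_class R x = A.
Proof. by have [x Ax] := svalP A; exists x; apply: quot_ext. Qed.

Hypotheses (Rrefl : forall x, R x x) (Rsym : forall x y, R x y -> R y x).
Hypothesis Rtrans : forall x y z, R x y -> R y z -> R x z.

Lemma quot_classP x y : quot_class R x = quot_class R y <-> R x y.
Proof.
split=> [/(congr1 sval) /= ->|Rxy]; first exact: Rrefl.
apply: quot_ext; apply: funext => z; apply: propext.
by split; apply: Rtrans => //; apply: Rsym.
Qed.

End Quotients.

(** A class is mapped to that of the image of a chosen representative; the
    forward implication of the hypothesis makes the choice irrelevant, the
    backward one gives injectivity. *)
Lemma quot_map_inj (T U : Type) (R : T -> T -> Prop) (S : U -> U -> Prop)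
    (f : T -> U) :
    (forall x y, quot_class R x = quot_class R y <->
                 quot_class S (f x) = quot_class S (f y)) ->
  exists nu : quot R -> quot S,
    (forall x, nu (quot_class R x) = quot_class S (f x)) /\ injective nu.
Proof.
move=> fP; pose r A := sval (cid (@quot_class_surj _ R A)).
have rK A : quot_class R (r A) = A by rewrite /r; case: cid.
exists (fun A => quot_class S (f (r A))); split=> [x|A B /fP].
  by apply/fP; rewrite rK.
by rewrite !rK.
Qed.

(** * Equivariant maps between principal bundles *)

(** In each fibre, [phi] is an equivariant map between two torsors: two points
    of the source with the same image differ by some [g] that fixes this image,
    whence [g = 1] by freeness, and the image, being nonempty and stable under
    [G], is the whole orbit that makes up the fibre of the target. *)
Lemma equivariant_over_bij (X : sset) (G : groupType) (P Q : bundle X G)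
    (phi : smap P Q) :
    (forall n (e : P n) g, phi n (gact e g) = gact (phi n e) g) ->
    (forall n (e : P n), proj Q n (phi n e) = proj P n e) ->
  forall n, bijective (phi n).
Proof.
move=> eqv over n.
have inj : injective (phi n).
  move=> e e' eqe; have : proj P n e = proj P n e' by rewrite -!over eqe.
  move=> /proj_orbit[g e'E]; move: eqe.
  by rewrite e'E eqv => /esym/gact_free ->; rewrite gact1.
have surj (t : Q n) : exists e, phi n e = t.
  have [e eE] := proj_surj P (proj Q n t).
  have /proj_orbit[g tE] : proj Q n (phi n e) = proj Q n t by rewrite over.
  by exists (gact e g); rewrite eqv.
pose psi t := sval (cid (surj t)).
have psiK : cancel psi (phi n) by move=> t; rewrite /psi; case: cid.
by exists psi => // e; apply: inj; rewrite psiK.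
Qed.

(** * Simplices of a nerve *)

Section NerveSimplices.
Variable K : category.

Definition const_functor (x : K) (D : category) : functor D K :=
  @Functor D K (fun=> x) (fun _ _ _ => idm x) (fun=> erefl)
    (fun _ _ _ _ _ => esym (mcomp1m (idm x))).

Definition const_ord m n (i : 'I_n.+1) : 'I_m.+1 -> 'I_n.+1 := fun=> i.

Fact const_ord_le m n (i : 'I_n.+1) :
  {homo @const_ord m n i : j k / (j <= k)%O}.
Proof. by move=> j k _; apply: le_refl. Qed.

HB.instance Definition _ m n (i : 'I_n.+1) :=
  Order.isOrderMorphism.Build _ 'I_m.+1 _ 'I_n.+1 (@const_ord m n i)
    (@const_ord_le m n i).

Definition vertex n (i : 'I_n.+1) (s : nerve K n) : nerve K 0 :=
  sact (@const_ord 0 n i : simplex_map 0 n) s.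

(** Every arrow of the poset [[0]] is an identity, so that a functor from it is
    determined by one object. *)
Lemma nerve0_ext (s t : nerve K 0) :
  s (ord0 : ord_cat 0) = t (ord0 : ord_cat 0) -> s = t.
Proof.
move=> est; apply: functor_eq => i j ij.
have i0 : i = ord0 := ord1 i; have j0 : j = ord0 := ord1 j; subst i j.
have -> : ij = idm (ord0 : ord_cat 0) by apply: bool_irrelevance.
by rewrite !fmap1 est.
Qed.

Variables (x y : K) (f : hom x y).

(** The 1-simplex of an arrow [f] is first described on booleans, ordered by
    [false <= true], where the arrows of a two-element chain can be enumerated
    by dependent pattern matching; ['I_2] is then mapped to [bool]. *)
Definition edge_ob (b : bool) : K := if b then y else x.

Definition edge_hom (a b : bool) : (a <= b)%O -> hom (edge_ob a) (edge_ob b) :=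
  match a, b with
  | false, false => fun=> idm x
  | false, true => fun=> f
  | true, true => fun=> idm y
  | true, false => fun h => False_rect _ (notF h)
  end.

Fact edge_le (i j : 'I_2) : (i <= j)%O -> ((i != ord0) <= (j != ord0))%O.
Proof. by case: i j => [[|[|i]] ?] [[|[|j]] ?]. Qed.

Fact edge_hom1 (a : bool) (h : (a <= a)%O) : edge_hom h = idm (edge_ob a).
Proof. by case: a h. Qed.

Fact edge_homM (a b c : bool) (ab : (a <= b)%O) (bc : (b <= c)%O)
  (ac : (a <= c)%O) : edge_hom ac = mcomp (edge_hom ab) (edge_hom bc).
Proof.
by case: a b c ab bc ac => [] [] [] //= *; rewrite ?mcomp1m ?mcompm1.
Qed.

Definition edge : nerve K 1 :=
  @Functor (ord_cat 1) K (fun i : 'I_2 => edge_ob (i != ord0))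
    (fun (i j : 'I_2) ij => edge_hom (edge_le ij))
    (fun i => edge_hom1 _) (fun i j k ij jk => edge_homM _ _ _).

End NerveSimplices.

(** * Gauge transformations and bundle maps *)

Section GaugeAndBundleMaps.
Local Open Scope group_scope.
Variables (C : category) (G : groupType) (F1 F2 : functor C (deloop G)).

Section GaugeToBundle.
Variables (Phi : C -> G) (PhiP : gauge Phi F1 F2).

(** The second component of the functor [gauge_PCF]; the inverse of [Phi] makes
    [(Phi x)^-1 * y1 * ((Phi x')^-1 * y2)^-1] equal to [F2 f] when
    [y1 * y2^-1 = F1 f] for [f : x -> x']. *)
Definition gauge_PCF_path : functor (PCF F1) (pathcat G) :=
  path_functor (fun u : PCF F1 => (Phi u.1)^-1 * u.2).

Fact gauge_PCF_proof (u v : PCF F1) (p : hom u v) :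
  gval F2 (fmap (Pi_F F1) p) = gval (Pi G) (fmap gauge_PCF_path p).
Proof.
have e : gval F1 (fmap (Pi_F F1) p) = u.2 * v.2^-1 := svalP p.
rewrite PiE; apply: (mulgI (Phi u.1)); rewrite -PhiP e /=.
by rewrite invgM invgK !mulgA mulgV mul1g.
Qed.

Definition gauge_PCF : functor (PCF F1) (PCF F2) := pb_pair gauge_PCF_proof.

Lemma gauge_bundle_iso : bundle_iso (nerve_bundle F1) (nerve_bundle F2).
Proof.
pose phi : smap (nerve_bundle F1) (nerve_bundle F2) := nerve_map gauge_PCF.
have over n (e : nerve_bundle F1 n) :
    proj (nerve_bundle F2) n (phi n e) = proj (nerve_bundle F1) n e.
  exact: functor_eq.
have eqv n (e : nerve_bundle F1 n) g : phi n (gact e g) = gact (phi n e) g.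
  apply: nerve_PCF_eq => [|i]; last by rewrite /= mulgA.
  rewrite [LHS]over proj_gact -over.
  exact: esym (proj_gact (phi n e) g).
by exists phi; split=> //; apply: equivariant_over_bij.
Qed.

End GaugeToBundle.

Section BundleToGauge.
Variable phi : smap (nerve_bundle F1) (nerve_bundle F2).
Hypothesis eqv : forall n (e : nerve_bundle F1 n) g,
  phi n (gact e g) = gact (phi n e) g.
Hypothesis over : forall n (e : nerve_bundle F1 n),
  proj (nerve_bundle F2) n (phi n e) = proj (nerve_bundle F1) n e.

Definition unit_vertex (x : C) : nerve (PCF F1) 0 :=
  const_functor ((x, 1) : PCF F1) (ord_cat 0).

(** As [phi] preserves the fibres of the projection, it sends the 0-simplex
    [(x, 1)] to [(x, translation x)]. *)
Definition translation (x : C) : G :=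
  (phi 0 (unit_vertex x) (ord0 : ord_cat 0)).2.

Lemma vertexE n (i : 'I_n.+1) (s : nerve (PCF F1) n) :
  vertex i s = nerve_gact (unit_vertex (s i).1) (s i).2.
Proof.
apply: nerve0_ext.
by rewrite /= mul1g; case: (s i).
Qed.

(** The [i]-th vertex of [s] is the translate by [(s i).2] of the 0-simplex
    [((s i).1, 1)], and [phi] commutes both with taking vertices and with
    translations. *)
Lemma bundle_map_vertex n (s : nerve (PCF F1) n) (i : 'I_n.+1) :
  (phi n s i).2 = translation (s i).1 * (s i).2.
Proof.
transitivity (phi 0%N (vertex i s) (ord0 : ord_cat 0)).2.
  by rewrite [phi 0%N _]smap_nat.
by rewrite vertexE [phi 0%N _]eqv.
Qed.

(** A 1-simplex [s] of [PCF F1] over [f] computes [F1 f] from its two vertices,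
    and [phi s], which lies over the same [f], computes [F2 f] from the
    translated ones. *)
Lemma bundle_map_gauge : gauge (fun x => (translation x)^-1) F1 F2.
Proof.
move=> x y f; have [s sE] := nerve_proj_surj F1 (edge f).
pose i0 : ord_cat 1 := (ord0 : 'I_2); pose i1 : ord_cat 1 := (ord_max : 'I_2).
have i01 : hom i0 i1 by [].
have phisE : nerve_map (Pi_F F2) 1%N (phi 1%N s) = edge f.
  by rewrite -sE [LHS]over.
have F1f : gval F1 f = (s i0).2 * (s i1).2^-1.
  by rewrite -(PCF_simplexE s i01) sE.
have F2f : gval F2 f = (phi 1%N s i0).2 * (phi 1%N s i1).2^-1.
  by rewrite -(PCF_simplexE (phi 1%N s) i01) phisE.
have ob_s i : (s i).1 = edge f i by rewrite -sE.
rewrite F1f F2f !bundle_map_vertex !ob_s /=.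
by rewrite invgM !mulgA mulVg mul1g.
Qed.

End BundleToGauge.

End GaugeAndBundleMaps.

Lemma nerve_bundle_isoP (C : category) (G : groupType)
    (F1 F2 : functor C (deloop G)) :
  bundle_iso (nerve_bundle F1) (nerve_bundle F2) <-> gauge_equiv F1 F2.
Proof.
split=> [[phi [_ eqv over]]|[Phi PhiP]]; last exact: (gauge_bundle_iso PhiP).
by eexists; apply: bundle_map_gauge eqv over.
Qed.

Theorem theorem7p1 (C : category) (G : groupType) :
  exists nu : orbits C G -> bundle_classes (nerve C) G,
    [/\ forall F : functor C (deloop G),
          nu (orbit_of F) = iso_class (nerve_bundle F),
        injective nu &
        forall c : bundle_classes (nerve C) G,
          (exists d, nu d = c) <->
          (exists F : functor C (deloop G), c = iso_class (nerve_bundle F))].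
Proof.
have [|nu [nuE nu_inj]] := @quot_map_inj _ _
    (@gauge_equiv C G) (@bundle_iso (nerve C) G) (@nerve_bundle C G).
  move=> F1 F2.
  rewrite (quot_classP (@gauge_equiv_refl C G) (@gauge_equiv_sym C G)
                       (@gauge_equiv_trans C G)).
  rewrite (quot_classP (@bundle_iso_refl _ G) (@bundle_iso_sym _ G)
                       (@bundle_iso_trans (nerve C) G)).
  exact: iff_sym (nerve_bundle_isoP F1 F2).
exists nu; split=> // c; split=> [[d <-]|[F ->]].
  by have [F <-] := quot_class_surj d; exists F; apply: nuE.
by exists (orbit_of F); apply: nuE.
Qed.
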